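(* Let $\mu$ be a finite Borel measure on $\mathbb{R}^d$ and $\theta\in(0,1]$. Then \[ \dim_{\mathrm F}^{\theta}(\mu*\mu)>\dim_{\mathrm F}^{\theta}\mu \] if and only if $\dim_{\mathrm F}^{\lambda\theta}\mu>\lambda\dim_{\mathrm F}^{\theta}\mu$ for some $\lambda\in[0,1)$. In particular, \[ \dim_{\mathrm S}(\mu*\mu)>\dim_{\mathrm S}\mu \] if and only if $\dim_{\mathrm F}^{\lambda}\mu>\lambda\dim_{\mathrm S}\mu$ for some $\lambda\in[0,1)$.
   Context: $\mu*\mu$ denotes the convolution of $\mu$ with itself. For a finite Borel measure $\mu$ on $\mathbb{R}^d$ write $\widehat\mu(z)=\int e^{-2\pi i z\cdot x}\,d\mu(x)$ for its Fourier transform. For $s\geq 0$ and $\theta\in(0,1]$ let $\mathcal{J}_{s,\theta}(\mu)=\left(\int_{\mathbb{R}^d}|\widehat\mu(z)|^{2/\theta}|z|^{s/\theta-d}\,dz\right)^{\theta}$, and let $\mathcal{J}_{s,0}(\mu)=\sup_{z\in\mathbb{R}^d}|\widehat\mu(z)|^2|z|^s$. The Fourier spectrum of $\mu$ at $\theta\in[0,1]$ is $\dim_{\mathrm F}^{\theta}\mu=\sup\{s\geq 0:\mathcal{J}_{s,\theta}(\mu)<\infty\}$, with $\sup\emptyset=0$, and $\dim_{\mathrm S}\mu=\dim_{\mathrm F}^{1}\mu$ is the Sobolev dimension of $\mu$.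
   Formalization: When the Fourier spectrum of μ at θ is infinite, the product λ·dim is read as ∞ also for λ = 0; with 0·∞ = 0 the equivalence would fail, e.g. for measures with smooth compactly supported density. *)

(* Defs.v *)
From HB Require Import structures.
From mathcomp Require Import all_boot all_order all_algebra.
From mathcomp Require Import all_classical all_reals all_analysis.
From mathcomp.real_closed Require Import complex.

Set Implicit Arguments.
Unset Strict Implicit.
Unset Printing Implicit Defensive.
Import Order.TTheory GRing.Theory Num.Theory.
Import numFieldNormedType.Exports.

Local Open Scope classical_set_scope.
Local Open Scope ring_scope.

(* The product sigma-algebra carried by tuples is the Borel sigma-algebra of
   R^d, R being second countable. *)
Notation euclidean R d := (d.-tuple (measurableTypeR R)).

Section euclidean_space.
Context {R : realType} {d : nat}.
Implicit Types x y : euclidean R d.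

Definition dotp x y : R := \sum_(i < d) (tnth x i : R) * (tnth y i : R).

Definition enorm x : R := Num.sqrt (dotp x x).

Definition addt x y : euclidean R d :=
  [tuple ((tnth x i : R) + (tnth y i : R)) | i < d].

End euclidean_space.

(* d-dimensional Lebesgue measure, as a d-fold product: on R^(n+1) it is the
   image of (Lebesgue on R) x (Lebesgue on R^n) under (a, t) |-> a :: t, and on
   the one-point space R^0 it is the unit mass. *)
Section lebesgue_euclidean.
Context {R : realType}.

Definition consp n (p : measurableTypeR R * euclidean R n) :
  euclidean R n.+1 := [tuple of p.1 :: p.2].

Lemma measurable_consp n : measurable_fun [set: _] (@consp n).
Proof. exact: measurable_cons measurable_fst measurable_snd. Qed.

Definition unconsp n (t : euclidean R n.+1) :
  measurableTypeR R * euclidean R n := (thead t, [tuple of behead t]).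

Lemma conspK n : cancel (@consp n) (@unconsp n).
Proof. by move=> [a t]; congr pair; exact/val_inj. Qed.

Lemma measurable_unconsp n : measurable_fun [set: _] (@unconsp n).
Proof.
apply/measurable_fun_pairP; split => /=; first exact: measurable_tnth.
exact: measurable_behead.
Qed.

Section step.
Variables (n : nat) (m : {sigma_finite_measure set (euclidean R n) -> \bar R}).

Definition lebesgue_consp : set (euclidean R n.+1) -> \bar R :=
  pushforward (@lebesgue_measure R \x m)%E (@consp n).

Let lebesgue_consp0 : lebesgue_consp set0 = 0%E.
Proof. by rewrite /lebesgue_consp /pushforward preimage_set0 measure0. Qed.

Let lebesgue_consp_ge0 A : (0 <= lebesgue_consp A)%E.
Proof. by apply: measure_ge0; exact: measurable_consp. Qed.

Let lebesgue_consp_sigma_additive : semi_sigma_additive lebesgue_consp.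
Proof.
apply: measure_semi_sigma_additive; exact: measurable_consp.
Qed.

HB.instance Definition _ := isMeasure.Build _ _ _ lebesgue_consp
  lebesgue_consp0 lebesgue_consp_ge0 lebesgue_consp_sigma_additive.

Let lebesgue_consp_sigma_finite : sigma_finite setT lebesgue_consp.
Proof.
have /sigma_finiteP[F [UF ndF finF]] := sigma_finiteT (@lebesgue_measure R).
have /sigma_finiteP[G [UG ndG finG]] := sigma_finiteT m.
exists (fun k => @unconsp n @^-1` (F k `*` G k)).
  rewrite -preimage_bigcup [X in _ @^-1` X](_ : _ = setT) ?preimage_setT//.
  apply/seteqP; split => // -[x y] _.
  have [i _ Fix] : (\bigcup_i F i) x by rewrite -UF.
  have [j _ Gjy] : (\bigcup_i G i) y by rewrite -UG.
  exists (maxn i j) => //; split => /=.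
    by move: x Fix; exact/subsetPset/ndF/leq_maxl.
  by move: y Gjy; exact/subsetPset/ndG/leq_maxr.
move=> k; have [mF Foo] := finF k; have [mG Goo] := finG k.
have mFG : measurable (F k `*` G k) by exact: measurableX.
split.
  by rewrite -[X in measurable X]setTI; exact: measurable_unconsp.
rewrite /lebesgue_consp /pushforward -comp_preimage.
rewrite (_ : _ \o _ = id); last by apply/funext => p /=; rewrite conspK.
by rewrite preimage_id product_measure1E// lte_mul_pinfty// ge0_fin_numE.
Qed.

HB.instance Definition _ := Measure_isSigmaFinite.Build _ _ _ lebesgue_consp
  lebesgue_consp_sigma_finite.

End step.

Fixpoint lebesgue_euclidean (d : nat) :
    {sigma_finite_measure set (euclidean R d) -> \bar R} :=
  match d with
  | 0 => \d_ ([tuple] : euclidean R 0)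
  | n.+1 => lebesgue_consp (lebesgue_euclidean n)
  end.

End lebesgue_euclidean.

Section convolution.
Context {R : realType} {d : nat}.
Variables mu nu : {finite_measure set (euclidean R d) -> \bar R}.

Definition convolution : set (euclidean R d) -> \bar R :=
  pushforward (mu \x nu)%E (fun p => addt p.1 p.2).

Let measurable_addt : measurable_fun [set: euclidean R d * euclidean R d]
  (fun p => addt p.1 p.2 : euclidean R d).
Proof.
apply/measurable_fun_tnthP => i.
rewrite (_ : _ \o _ = (fun p : euclidean R d * euclidean R d =>
  (tnth p.1 i : R) + (tnth p.2 i : R))); last first.
  by apply/funext => p /=; rewrite tnth_mktuple.
apply: measurable_realfun.measurable_funD.
  exact: measurableT_comp (measurable_tnth i) measurable_fst.
exact: measurableT_comp (measurable_tnth i) measurable_snd.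
Qed.

Let convolution0 : convolution set0 = 0%E.
Proof. by rewrite /convolution /pushforward preimage_set0 measure0. Qed.

Let convolution_ge0 A : (0 <= convolution A)%E.
Proof. by apply: measure_ge0; exact: measurable_addt. Qed.

Let convolution_sigma_additive : semi_sigma_additive convolution.
Proof.
apply: measure_semi_sigma_additive; exact: measurable_addt.
Qed.

HB.instance Definition _ := isMeasure.Build _ _ _ convolution
  convolution0 convolution_ge0 convolution_sigma_additive.

Let convolution_finite : fin_num_fun convolution.
Proof.
apply: lty_fin_num_fun.
rewrite /= /convolution /pushforward preimage_setT -setXTT product_measure1E//.
by rewrite lte_mul_pinfty// ?ltey_eq ?fin_num_measure.
Qed.

HB.instance Definition _ :=
  Measure_isFinite.Build _ _ _ convolution convolution_finite.

End convolution.

Section fourier_spectrum.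
Context {R : realType} {d : nat}.
Implicit Types (mu : {finite_measure set (euclidean R d) -> \bar R})
  (z : euclidean R d) (s theta : R).

Definition cis (t : R) : R[i] := Complex (cos t) (sin t).

Definition Cintegral mu (f : euclidean R d -> R[i]) : R[i] :=
  Complex (\int[mu]_x complex.Re (f x)) (\int[mu]_x complex.Im (f x)).

Definition fourier mu z : R[i] :=
  Cintegral mu (fun x => cis (- (2 * pi * dotp z x))).

(* normc rather than `|_|, whose values on R[i] are again in R[i]. *)
Definition fourier_abs mu z : R := Normc.normc (fourier mu z).

(* In MathComp 0 `^ r = 0 for r != 0, including r < 0; the integrand is thus
   set to 0 at the null point z = 0 when its exponent is negative. *)
Definition energy mu s theta : \bar R :=
  if theta == 0 then
    ereal_sup (range (fun z => (fourier_abs mu z ^+ 2 * enorm z `^ s)%:E))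
  else
    poweR (\int[lebesgue_euclidean d]_z
      (fourier_abs mu z `^ (2 / theta) *
       enorm z `^ (s / theta - d%:R))%:E)%E theta.

(* [ereal_sup set0] is -oo: the maximum with 0 implements [sup set0 = 0] and
   changes nothing on nonempty sets, whose elements are nonnegative. *)
Definition dimF theta mu : \bar R :=
  Order.max 0%E
    (ereal_sup [set s%:E | s in [set s : R | 0 <= s /\ (energy mu s theta < +oo)%E]]).

Definition dimS mu : \bar R := dimF 1 mu.

End fourier_spectrum.

(* lam times an extended real x >= 0, with lam * oo = oo for every lam in [0, 1),
   lam = 0 included. The library has 0 * +oo = 0, under which a smooth
   density, all of whose dimensions are +oo, would satisfy
   dimF (0 * theta) mu > 0 * dimF theta mu although
   dimF theta (mu * mu) = dimF theta mu = +oo. *)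
Definition scale_dim {R : realType} (lam : R) (x : \bar R) : \bar R :=
  if x == +oo%E then +oo%E else (lam%:E * x)%E.

(* Main.v *)
Require Import Defs.
From HB Require Import structures.
From mathcomp Require Import all_boot all_order all_algebra.
From mathcomp Require Import all_classical all_reals all_analysis.
From mathcomp Require Import measurable_realfun ring lra.

(* Since the Fourier transform of mu * mu is the square of that of mu,
   dimF theta (mu * mu) = 2 dimF (theta / 2) mu; this gives the direct
   implication with lam = 1/2.  Conversely, put f theta = dimF theta mu.
   Concavity of f on [0, 1] gives f (theta / 2) > f theta / 2 as soon as
   f (lam theta) > lam f theta for one lam < 1: interpolate between 0 and
   lam theta if lam >= 1/2, and between lam theta and theta if lam < 1/2.
   In the second case no s > 0 may have finite energy at theta when
   f theta = 0; then f (theta / 2) > 0 follows from the monotonicity of f.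

   Concavity needs no Hoelder inequality: an energy of order (s, theta) is
   finite if and only if |F mu|^2 |z|^s <= C (|z|^d H)^theta off the origin for
   some integrable H >= 0.  Such bounds multiply, with H0 + H1 as the new H,
   and at theta = 0 the bound reduces to the supremum defining the energy.
   Monotonicity follows by adding to H the integrable weight
   |z|^-d min(|z|^e, |z|^-e). *)

Set Implicit Arguments.
Unset Strict Implicit.
Unset Printing Implicit Defensive.
Import Order.TTheory GRing.Theory Num.Theory.
Import numFieldNormedType.Exports.

Local Open Scope classical_set_scope.
Local Open Scope ring_scope.

(** * Measurability of the norm, the inner product and addition on R^d *)

Section euclidean.
Context {R : realType} {d : nat}.
Implicit Types x y z : euclidean R d.

Lemma dotp_addt z x y : dotp z (addt x y) = dotp z x + dotp z y.
Proof.
by rewrite /dotp -big_split; apply: eq_bigr => i _; rewrite tnth_mktuple mulrDr.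
Qed.

Lemma measurable_dotp d' (T : measurableType d') (f g : T -> euclidean R d) :
  measurable_fun setT f -> measurable_fun setT g ->
  measurable_fun setT (fun t => dotp (f t) (g t)).
Proof.
move=> mf mg; apply: measurable_sum => i.
by apply: measurable_funM; apply: (measurableT_comp (measurable_tnth i)).
Qed.

Lemma measurable_enorm : measurable_fun setT (@enorm R d).
Proof.
apply: (measurableT_comp (continuous_measurable_fun (@sqrt_continuous R))).
exact: measurable_dotp.
Qed.

Lemma enorm_ge0 z : 0 <= enorm z.
Proof. exact: sqrtr_ge0. Qed.

Lemma tnth_le_enorm z i : `|tnth z i : R| <= enorm z.
Proof.
rewrite -sqrtr_sqr; apply: ler_wsqrtr.
by rewrite /dotp (bigD1 i)//= -expr2 lerDl sumr_ge0// => j _; exact: sqr_ge0.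
Qed.

Lemma measurable_addt :
  measurable_fun setT (fun p : euclidean R d * euclidean R d => addt p.1 p.2).
Proof.
apply/measurable_fun_tnthP => i.
rewrite (_ : _ \o _ = (fun p : euclidean R d * euclidean R d =>
  (tnth p.1 i : R) + (tnth p.2 i : R))); last first.
  by apply/funext => p /=; rewrite tnth_mktuple.
apply: measurable_funD.
  exact: measurableT_comp (measurable_tnth i) measurable_fst.
exact: measurableT_comp (measurable_tnth i) measurable_snd.
Qed.

End euclidean.

(** * Bounded functions on finite measure spaces *)

Section bounded_integrals.
Context {R : realType}.

Lemma bounded_integrable d (T : measurableType d)
    (m : {measure set T -> \bar R}) (f : T -> R) (M : R) :
  (m setT < +oo)%E -> measurable_fun setT f -> (forall t, `|f t| <= M) ->
  m.-integrable setT (EFin \o f).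
Proof.
move=> moo mf fM; apply: measurable_bounded_integrable => //.
exists M; split; first exact: num_real.
by move=> N MN t _; rewrite /= (le_trans (fM t))// ltW.
Qed.

Lemma finite_measure_lty d (T : measurableType d)
    (m : {finite_measure set T -> \bar R}) : (m setT < +oo)%E.
Proof. by rewrite ltey_eq fin_num_measure. Qed.

Lemma normr_Rintegral_le d (T : measurableType d)
    (m : {finite_measure set T -> \bar R}) (f : T -> R) (M : R) :
  measurable_fun setT f -> (forall t, `|f t| <= M) ->
  `|\int[m]_t f t| <= M * fine (m setT).
Proof.
move=> mf fM; have intf := bounded_integrable (finite_measure_lty m) mf fM.
rewrite (le_trans (le_normr_Rintegral _ intf))// -Rintegral_cst//.
apply: le_Rintegral => //.
- apply: (bounded_integrable (M := M)) => //; first exact: finite_measure_lty.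
    exact: measurableT_comp.
  by move=> t; rewrite normr_id.
- apply: (bounded_integrable (M := `|M|)) => //; exact: finite_measure_lty.
Qed.

Context d1 d2 (T1 : measurableType d1) (T2 : measurableType d2).

Lemma product_measure_lty (m1 : {finite_measure set T1 -> \bar R})
    (m2 : {finite_measure set T2 -> \bar R}) : ((m1 \x m2) setT < +oo)%E.
Proof.
rewrite -setXTT product_measure1E//.
by rewrite lte_mul_pinfty// ?finite_measure_lty ?fin_num_measure.
Qed.

Lemma RintegralM (m1 : {finite_measure set T1 -> \bar R})
    (m2 : {finite_measure set T2 -> \bar R}) (f : T1 -> R) (g : T2 -> R) (M N : R) :
  measurable_fun setT f -> measurable_fun setT g ->
  (forall t, `|f t| <= M) -> (forall t, `|g t| <= N) ->
  \int[(m1 \x m2)%E]_p (f p.1 * g p.2) = \int[m1]_x f x * \int[m2]_y g y.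
Proof.
move=> mf mg fM gN.
have intf := bounded_integrable (finite_measure_lty m1) mf fM.
have intg := bounded_integrable (finite_measure_lty m2) mg gN.
have intfg : (m1 \x m2)%E.-integrable setT
    (EFin \o (fun p : T1 * T2 => f p.1 * g p.2)).
  apply: (@bounded_integrable _ _ _ _ (M * N)); first exact: product_measure_lty.
    apply: measurable_funM; first exact: measurableT_comp mf measurable_fst.
    exact: measurableT_comp mg measurable_snd.
  by move=> t; rewrite normrM ler_pM.
rewrite {1}/Rintegral -(integral12_prod_meas1 intfg) -RintegralZr//.
rewrite /Rintegral; congr fine; apply: eq_integral => x _.
rewrite /fubini_F/=; under eq_integral do rewrite EFinM.
rewrite integralZl// EFinM fineK//; exact: integrable_fin_num.
Qed.

(** Tonelli's measurability theorem applies to nonnegative functions only, so the integrand is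
    shifted up by its bound [M] and the constant integral of [M] is subtracted afterwards. *)
Lemma measurable_fun_Rintegral (m : {finite_measure set T2 -> \bar R})
    (f : T1 -> T2 -> R) (M : R) :
  measurable_fun setT (fun p : T1 * T2 => f p.1 p.2) ->
  (forall x y, `|f x y| <= M) ->
  measurable_fun setT (fun x => \int[m]_y f x y).
Proof.
move=> mf fM.
have mfx x : measurable_fun setT (f x).
  exact: (measurableT_comp mf (measurable_pair1 x)).
have intf x := bounded_integrable (finite_measure_lty m) (mfx x) (fM x).
have intM : m.-integrable setT (EFin \o cst M).
  apply: (bounded_integrable (M := `|M|)) => //; exact: finite_measure_lty.
rewrite (_ : (fun x => _) = (fun x => fine (\int[m]_y (f x y + M)%:E) - \int[m]_y M)); last first.
  apply/funext => x; rewrite -[X in X - _]/(Rintegral _ _ _) RintegralD//.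
  by rewrite addrK.
apply: measurable_funB => //.
apply: measurableT_comp => //.
apply: (@measurable_fun_fubini_tonelli_F _ _ _ _ _ m (fun p => (f p.1 p.2 + M)%:E)).
  by apply/measurable_EFinP/measurable_funD.
by move=> p; rewrite lee_fin -lerBlDr sub0r; have := fM p.1 p.2; rewrite ler_norml => /andP[].
Qed.

End bounded_integrals.

(** * The modulus of the Fourier transform, and its value for [mu * mu] *)

Section fourier.
Context {R : realType} {d : nat}.
Implicit Types (mu : {finite_measure set (euclidean R d) -> \bar R})
  (x z : euclidean R d).

Definition phase z x : R := - (2 * pi * dotp z x).

Lemma measurable_phase : measurable_fun setT
  (fun p : euclidean R d * euclidean R d => phase p.1 p.2).
Proof.
apply: measurable_funN; apply: measurable_funM => //.
exact: measurable_dotp.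
Qed.

Lemma measurable_cos_phase : measurable_fun setT
  (fun p : euclidean R d * euclidean R d => cos (phase p.1 p.2)).
Proof.
exact: (measurableT_comp (continuous_measurable_fun (@continuous_cos R))
  measurable_phase).
Qed.

Lemma measurable_sin_phase : measurable_fun setT
  (fun p : euclidean R d * euclidean R d => sin (phase p.1 p.2)).
Proof.
exact: (measurableT_comp (continuous_measurable_fun (@continuous_sin R))
  measurable_phase).
Qed.

Lemma normr_cos_le1 (t : R) : `|cos t| <= 1.
Proof. by rewrite ler_norml cos_geN1 cos_le1. Qed.

Lemma normr_sin_le1 (t : R) : `|sin t| <= 1.
Proof. by rewrite ler_norml sin_geN1 sin_le1. Qed.

(** The real and imaginary parts of the Fourier transform; every later computation is done on these
    two real integrals. *)
Definition fcos mu z := \int[mu]_x cos (phase z x).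
Definition fsin mu z := \int[mu]_x sin (phase z x).

Lemma fourier_absE mu z :
  fourier_abs mu z = Num.sqrt (fcos mu z ^+ 2 + fsin mu z ^+ 2).
Proof. by []. Qed.

Lemma fourier_abs_ge0 mu z : 0 <= fourier_abs mu z.
Proof. exact: sqrtr_ge0. Qed.

Lemma measurable_fourier_abs mu : measurable_fun setT (fourier_abs mu).
Proof.
apply: (measurableT_comp (continuous_measurable_fun (@sqrt_continuous R))).
apply: measurable_funD; apply: measurable_funX.
  apply: (measurable_fun_Rintegral _ measurable_cos_phase) => *.
  exact: normr_cos_le1.
apply: (measurable_fun_Rintegral _ measurable_sin_phase) => *.
exact: normr_sin_le1.
Qed.

Lemma fourier_abs_bounded mu : exists2 M : R, 0 < M & forall z, fourier_abs mu z <= M.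
Proof.
pose K := fine (mu setT); have K0 : 0 <= K by exact: fine_ge0.
(* A crude constant suffices: both parts are at most the total mass [K], and the summand 1 keeps the
   bound positive when [mu] is zero. *)
exists (2 * K + 1); first by rewrite ltr_wpDl// mulr_ge0.
move=> z; rewrite fourier_absE.
have hc : `|fcos mu z| <= K.
  rewrite -[K]mul1r; apply: normr_Rintegral_le => [|x]; last exact: normr_cos_le1.
  exact: (measurableT_comp measurable_cos_phase (measurable_pair1 z)).
have hs : `|fsin mu z| <= K.
  rewrite -[K]mul1r; apply: normr_Rintegral_le => [|x]; last exact: normr_sin_le1.
  exact: (measurableT_comp measurable_sin_phase (measurable_pair1 z)).
rewrite -[leRHS]ger0_norm; last by rewrite addr_ge0// mulr_ge0.
rewrite -sqrtr_sqr ler_wsqrtr//.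
rewrite -[X in X + _]real_normK ?num_real// -[X in _ + X]real_normK ?num_real//.
have := normr_ge0 (fcos mu z); have := normr_ge0 (fsin mu z).
nra.
Qed.

(** The addition formulas turn the integrals against the convolution into products over [mu \x mu].
    With c and s the cosine and sine integrals of [mu], those of the convolution are c^2 - s^2 and
    2sc, and (c^2 - s^2)^2 + (2sc)^2 = (c^2 + s^2)^2. *)
Lemma fourier_abs_convolution mu z :
  fourier_abs (convolution mu mu) z = fourier_abs mu z ^+ 2.
Proof.
have mc : measurable_fun setT (fun x => cos (phase z x)).
  exact: (measurableT_comp measurable_cos_phase (measurable_pair1 z)).
have ms : measurable_fun setT (fun x => sin (phase z x)).
  exact: (measurableT_comp measurable_sin_phase (measurable_pair1 z)).
have pf (f : euclidean R d -> R) : measurable_fun setT f -> (forall x, `|f x| <= 1) ->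
    \int[convolution mu mu]_x f x = \int[(mu \x mu)%E]_p f (addt p.1 p.2).
  move=> mf f1; rewrite /Rintegral; congr fine.
  rewrite (integral_pushforward measurable_addt)//; first exact/measurable_EFinP.
  rewrite preimage_setT.
  apply: (@bounded_integrable _ _ _ _ (fun p => f (addt p.1 p.2)) 1) => //.
    exact: product_measure_lty.
  exact: (measurableT_comp mf measurable_addt).
have phaseD x y : phase z (addt x y) = phase z x + phase z y.
  by rewrite /phase dotp_addt; ring.
have im (f g : euclidean R d -> R) : measurable_fun setT f -> measurable_fun setT g ->
    (forall x, `|f x| <= 1) -> (forall x, `|g x| <= 1) ->
    (mu \x mu)%E.-integrable setT (EFin \o (fun p => f p.1 * g p.2)).
  move=> mf mg f1 g1.
  apply: (@bounded_integrable _ _ _ _ _ (1 * 1)); first exact: product_measure_lty.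
    apply: measurable_funM; first exact: measurableT_comp mf measurable_fst.
    exact: measurableT_comp mg measurable_snd.
  by move=> t; rewrite normrM ler_pM.
have c1 x : `|cos (phase z x)| <= 1 by exact: normr_cos_le1.
have s1 x : `|sin (phase z x)| <= 1 by exact: normr_sin_le1.
have hc : fcos (convolution mu mu) z = fcos mu z ^+ 2 - fsin mu z ^+ 2.
  rewrite /fcos pf//.
  under eq_Rintegral do rewrite phaseD cosD.
  rewrite RintegralB//; [|exact: (im _ _ mc mc)|exact: (im _ _ ms ms)].
  by rewrite (RintegralM _ _ mc mc c1 c1) (RintegralM _ _ ms ms s1 s1) -!expr2.
have hs : fsin (convolution mu mu) z = fsin mu z * fcos mu z *+ 2.
  rewrite /fsin pf//.
  under eq_Rintegral do rewrite phaseD sinD.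
  rewrite RintegralD//; [|exact: (im _ _ ms mc)|exact: (im _ _ mc ms)].
  by rewrite (RintegralM _ _ ms mc s1 c1) (RintegralM _ _ mc ms c1 s1) [X in _ + X]mulrC mulr2n.
rewrite !fourier_absE hc hs sqr_sqrtr ?addr_ge0 ?sqr_ge0//.
rewrite -[RHS]ger0_norm ?addr_ge0 ?sqr_ge0// -sqrtr_sqr; congr Num.sqrt.
ring.
Qed.

End fourier.

(** * Lebesgue measure of cubes, and an integrable weight on R^d *)

Section lebesgue_euclidean_facts.
Context {R : realType}.

(** Cubes stand in for Euclidean balls: they are products of intervals, so their measure follows by
    induction on [d], and they contain the ball of radius [r]. *)
Definition cube d (r : R) : set (euclidean R d) :=
  [set z | forall i, `|(tnth z i : R)| <= r].

Arguments cube d r : clear implicits.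

Lemma measurable_cube d r : measurable (cube d r).
Proof.
rewrite (_ : cube d r = \bigcap_(i in [set: 'I_d])
    ((fun z : euclidean R d => tnth z i) @^-1` (`[- r, r]%classic))); last first.
  apply/seteqP; split => z hz i.
    by move=> _ /=; rewrite in_itv/= -ler_norml; exact: hz.
  by have := hz i I; rewrite /= in_itv/= -ler_norml.
apply: fin_bigcap_measurable => [|i _]; first exact: finite_finset.
 rewrite -[X in measurable X]setTI.
by apply: (measurable_tnth i) => //; exact: measurable_itv.
Qed.

Lemma lebesgue_cube d r : 0 <= r ->
  lebesgue_euclidean d (cube d r) = ((2 * r) ^+ d)%:E.
Proof.
move=> r0; elim: d => [|n IHn].
  rewrite /= diracE mem_set ?expr0// => i.
  by case: i.
rewrite /= /lebesgue_consp /pushforward.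
rewrite (_ : _ @^-1` _ = `[- r, r]%classic `*` cube n r); last first.
  apply/seteqP; split => -[a t] /=.
    move=> h; split => /=; first by rewrite in_itv/= -ler_norml; exact: (h ord0).
    by move=> i; have := h (lift ord0 i); rewrite tnthS.
  move=> [/=]; rewrite in_itv/= -ler_norml => ha ht i.
  by case: (unliftP ord0 i) => [j|] ->; [rewrite tnthS; exact: ht|].
rewrite product_measure1E//; last exact: measurable_cube.
rewrite IHn exprS EFinM; congr (_ * _)%E.
transitivity (lebesgue_measure (`[- r, r]%classic : set R)) => //.
rewrite lebesgue_measure_itv/= lte_fin.
have [r_gt0|rr] := ltP (- r) r; last by congr EFin; lra.
by rewrite -EFinB; congr EFin; ring.
Qed.

Lemma enorm_eq0 d (z : euclidean R d) i : enorm z = 0 -> tnth z i = 0.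
Proof.
move=> z0; apply/eqP; rewrite -normr_le0 -z0; exact: tnth_le_enorm.
Qed.

Lemma measurable_enorm0 d : measurable [set z : euclidean R d | enorm z = 0].
Proof.
rewrite -[X in measurable X]setTI.
exact: (@measurable_enorm R d measurableT [set 0] (measurable_set1 0)).
Qed.

(** The origin lies in the null slab {0} x R^n. On R^0 the claim fails, since the measure there is a
    unit mass at the only point. *)
Lemma lebesgue_enorm0 d : (0 < d)%N ->
  lebesgue_euclidean d [set z : euclidean R d | enorm z = 0] = 0%E.
Proof.
case: d => // n _; apply/eqP; rewrite eq_le measure_ge0 andbT.
rewrite /= /lebesgue_consp /pushforward.
apply: (@le_trans _ _ ((lebesgue_measure \x lebesgue_euclidean n)%E
  ([set 0] `*` [set: euclidean R n]))).
  apply: le_measure; rewrite ?inE.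
  - rewrite -[X in measurable X]setTI.
    by apply: (measurable_consp (n := n)) => //; exact: measurable_enorm0.
  - by apply: measurableX => //; exact: measurable_set1.
  - by move=> [a t] /= /(enorm_eq0 ord0) h; split.
rewrite product_measure1E//.
rewrite (_ : (_ * _)%E = 0%E)// -[RHS](mul0e (lebesgue_euclidean n setT)).
by congr (_ * _)%E; exact: (lebesgue_measure_set1 (0 : R)).
Qed.

Lemma dyadic_bracket (x : R) : 1 <= x -> exists k, 2 ^+ k <= x < 2 ^+ k.+1.
Proof.
move=> x1; pose t := Num.trunc x.
have t0 : (0 < t)%N by rewrite truncn_gt0.
have /andP[tx xt] := truncn_itv (le_trans ler01 x1).
exists (trunc_log 2 t); apply/andP; split.
  by rewrite (le_trans _ tx)// -natrX ler_nat trunc_logP.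
by rewrite (lt_le_trans xt)// -natrX ler_nat trunc_log_ltn.
Qed.

(* On the dyadic shell rho k <= |z| <= 2 rho k, [weight] is at most
   q ^ k (rho k)^-d with q = 2^-e, and the cube of half-side 2 rho k contains it. *)
Definition shell_term d (q : R) (rho : nat -> R) k (z : euclidean R d) : R :=
  q ^+ k * rho k ^- d * \1_(cube d (2 * rho k)) z.

Lemma shell_term_ge0 d q rho k (z : euclidean R d) :
  0 <= q -> (forall k, 0 < rho k) -> 0 <= shell_term q rho k z.
Proof.
move=> q0 rho0; rewrite mulr_ge0// mulr_ge0// ?exprn_ge0//.
by rewrite invr_ge0 exprn_ge0// ltW.
Qed.

Lemma measurable_shell_term d q rho k :
  measurable_fun setT (@shell_term d q rho k).
Proof.
apply: measurable_funM => //; apply: measurable_indic; exact: measurable_cube.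
Qed.

(** The cube has volume (4 rho k)^d, which cancels the factor (rho k)^-d: the k-th term integrates
    to 4^d q^k whatever the radii, and the series is geometric. *)
Lemma shell_series_lty d (q : R) (rho : nat -> R) :
  0 < q < 1 -> (forall k, 0 < rho k) ->
  (\int[lebesgue_euclidean d]_z \sum_(k <oo) (shell_term q rho k z)%:E < +oo)%E.
Proof.
move=> /andP[q0 q1] rho0.
rewrite integral_nneseries//; last 2 first.
- by move=> k; apply/measurable_EFinP; exact: measurable_shell_term.
- by move=> k z _; rewrite lee_fin shell_term_ge0// ltW.
have intE k : (\int[lebesgue_euclidean d]_z (shell_term q rho k z)%:E =
    (4 ^+ d * q ^+ k)%:E)%E.
  have c0 : 0 <= q ^+ k * rho k ^- d.
    by rewrite mulr_ge0 ?exprn_ge0 ?invr_ge0 ?exprn_ge0// ltW.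
  under eq_integral do rewrite /shell_term EFinM.
  rewrite ge0_integralZl_EFin//; last first.
    by apply/measurable_EFinP/measurable_indic; exact: measurable_cube.
  rewrite integral_indic//; last exact: measurable_cube.
  rewrite setIT [X in (_ * X)%E](_ : _ = ((2 * (2 * rho k)) ^+ d)%:E); last first.
    by apply: lebesgue_cube; rewrite mulr_ge0// ltW.
  rewrite -EFinM; congr EFin.
  have rd : rho k ^+ d != 0 by rewrite expf_neq0// gt_eqF.
  by rewrite !exprMn (_ : 4 = 2 * 2 :> R) ?exprMn; [field|ring].
under eq_eseriesr do rewrite intE.
apply: (@le_lt_trans _ _ (4 ^+ d / (1 - q))%:E); last exact: ltry.
apply: lime_le.
  by apply: is_cvg_nneseries => n _ _; rewrite lee_fin mulr_ge0 ?exprn_ge0// ltW.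
apply: nearW => n; rewrite sumEFin lee_fin.
by apply: (geometric_le_lim n) => //; rewrite gtr0_norm.
Qed.

Definition weight d (e : R) (z : euclidean R d) : R :=
  enorm z ^- d * Num.min (enorm z `^ e) (enorm z `^ (- e)).

Lemma weight_ge0 d e (z : euclidean R d) : 0 <= weight e z.
Proof.
by rewrite mulr_ge0// ?invr_ge0 ?exprn_ge0 ?enorm_ge0// le_min !powR_ge0.
Qed.

Lemma measurable_weight d e : measurable_fun setT (@weight d e).
Proof.
have -> : @weight d e = (fun z => Num.min (enorm z `^ e) (enorm z `^ (- e)) *
    enorm z `^ (- d%:R)).
  apply/funext => z; rewrite /weight mulrC powR_invn//; exact: enorm_ge0.
have mp p : measurable_fun setT (fun z : euclidean R d => enorm z `^ p).
  exact: (measurableT_comp (measurable_powR p) measurable_enorm).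
by apply: measurable_funM => //; apply: measurable_minr.
Qed.

(** The first series covers the dyadic shells outside the unit ball, with inner radii 2^k, and the
    second those inside, with inner radii 2^-(k+1). *)
Lemma weight_le_shells d e (z : euclidean R d) : (0 < d)%N -> 0 < e ->
  ((weight e z)%:E <=
     \sum_(k <oo) (shell_term (2 `^ (- e)) (fun k => 2 ^+ k) k z)%:E +
     \sum_(k <oo) (shell_term (2 `^ (- e)) (fun k => 2 ^- k.+1) k z)%:E)%E.
Proof.
move=> d0 e0; set q := 2 `^ (- e); have q0 : 0 <= q by exact: powR_ge0.
have qE k : q ^+ k = (2 ^+ k) `^ (- e).
  by rewrite -!powR_mulrn// ?powR_ge0// -!powRrM mulrC.
have rho1 k : 0 < (2 : R) ^+ k by rewrite exprn_gt0.
have rho2 k : 0 < (2 : R) ^- k.+1 by rewrite invr_gt0 exprn_gt0.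
have addl (a b c : \bar R) : (0 <= a -> c <= b -> c <= a + b)%E.
  by move=> a0 cb; rewrite (le_trans cb)// leeDr.
have addr (a b c : \bar R) : (0 <= b -> c <= a -> c <= a + b)%E.
  by move=> b0 ca; rewrite (le_trans ca)// leeDl.
have term rho k : (forall k, 0 < rho k) -> enorm z <= 2 * rho k ->
    weight e z <= q ^+ k * rho k ^- d ->
    ((weight e z)%:E <= \sum_(k <oo) (shell_term q rho k z)%:E)%E.
  (* The k-th term alone dominates the weight; it is the last one of the partial sum of length
     [k.+1]. *)
  move=> rho0 zr wr; apply: le_trans (nneseries_lim_ge k.+1 _) => [|n _ _]; last first.
    by rewrite lee_fin shell_term_ge0.
  rewrite big_nat_recr//=; apply: addl.
    by apply: sume_ge0 => n _; rewrite lee_fin shell_term_ge0.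
  rewrite lee_fin /shell_term indicE mem_set ?mulr1// => i.
  exact: le_trans (tnth_le_enorm z i) zr.
have s0 rho : (forall k, 0 < rho k) ->
    (0 <= \sum_(k <oo) (shell_term q rho k z)%:E)%E.
  by move=> rho0; apply: nneseries_ge0 => n _ _; rewrite lee_fin shell_term_ge0.
have [z1|z1] := leP 1 (enorm z).
  have [k /andP[kz zk]] := dyadic_bracket z1.
  have z0 : 0 < enorm z by exact: lt_le_trans ltr01 z1.
  apply: addr; first exact: s0.
  apply: (term _ k) => //; first by rewrite -exprS ltW.
  rewrite /weight mulrC ler_pM ?le_min ?powR_ge0 ?invr_ge0 ?exprn_ge0 ?enorm_ge0//.
    rewrite ge_min; apply/orP; right; rewrite qE !powRN lef_pV2 ?posrE ?powR_gt0//.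
    by apply: ge0_ler_powR; rewrite ?nnegrE// ltW.
  by rewrite lef_pV2 ?posrE ?exprn_gt0// lerXn2r// nnegrE ltW.
apply: addl; first exact: s0.
have := enorm_ge0 z; rewrite le_eqVlt => /predU1P[z0|z0].
  (* At the origin the weight is 0, because 0^d = 0 for d > 0 and the inverse of 0 is 0. *)
  rewrite /weight -z0 expr0n gtn_eqF//= invr0 mul0r; exact: s0.
(* Inside the punctured unit ball the shell is found by bracketing 1/|z| instead. *)
have zV1 : 1 <= (enorm z)^-1 by rewrite invf_ge1// ltW.
have [k /andP[kz zk]] := dyadic_bracket zV1.
have zle : enorm z <= 2 ^- k.
  by rewrite -[leLHS]invrK lef_pV2 ?posrE ?invr_gt0 ?exprn_gt0.
have lez : 2 ^- k.+1 <= enorm z.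
  by rewrite -[leRHS]invrK lef_pV2 ?posrE ?invr_gt0 ?exprn_gt0 ?ltW.
apply: (term _ k) => //.
  by rewrite exprS invfM mulrA divff// mul1r.
rewrite /weight mulrC ler_pM ?le_min ?powR_ge0 ?invr_ge0 ?exprn_ge0 ?enorm_ge0//.
  rewrite ge_min; apply/orP; left; rewrite qE powRN -powR_inv1 ?powR_ge0//.
  rewrite powRAC powR_inv1 ?exprn_ge0//.
  by apply: ge0_ler_powR; rewrite ?nnegrE// ltW.
by rewrite lef_pV2 ?posrE ?exprn_gt0// lerXn2r// nnegrE ltW.
Qed.

Lemma integral_weight_lty d e : (0 < d)%N -> 0 < e ->
  (\int[lebesgue_euclidean d]_z (weight e z)%:E < +oo)%E.
Proof.
move=> d0 e0; pose q : R := 2 `^ (- e).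
have q01 : 0 < q < 1.
  rewrite /q powR_gt0//= powRN invf_lt1 ?powR_gt0//.
  (* The left-hand 1 is rewritten as 1^e, to be compared with 2^e. *)
  by rewrite -[ltLHS](congr1 (fun f => f e) (powR1 R)) gt0_ltr_powR ?nnegrE// ltr1n.
have rho1 k : 0 < (2 : R) ^+ k by rewrite exprn_gt0.
have rho2 k : 0 < (2 : R) ^- k.+1 by rewrite invr_gt0 exprn_gt0.
have s0 rho z : (forall k, 0 < rho k) ->
    (0 <= \sum_(k <oo) (@shell_term d q rho k z)%:E)%E.
  move=> rho0; apply: nneseries_ge0 => n _ _.
  by rewrite lee_fin shell_term_ge0// powR_ge0.
have ms rho : (forall k, 0 < rho k) ->
    measurable_fun setT (fun z => \sum_(k <oo) (@shell_term d q rho k z)%:E)%E.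
  move=> rho0; apply: ge0_emeasurable_sum => [k z _ _|k _].
    by rewrite lee_fin shell_term_ge0// powR_ge0.
  by apply/measurable_EFinP; exact: measurable_shell_term.
apply: le_lt_trans.
  apply: ge0_le_integral (fun z _ => weight_le_shells z d0 e0) => //.
  - by move=> z _; rewrite lee_fin weight_ge0.
  - by apply/measurable_EFinP; exact: measurable_weight.
  - by apply: emeasurable_funD; exact: ms.
rewrite ge0_integralD//; [|by move=> z _; exact: s0|exact: ms|by move=> z _; exact: s0|exact: ms].
by apply: lte_add_pinfty; exact: shell_series_lty.
Qed.

End lebesgue_euclidean_facts.

(** * Addition of real exponents *)

Lemma powRD_gt0 {R : realType} (x a b : R) : 0 < x ->
  x `^ (a + b) = x `^ a * x `^ b.
Proof. by move=> x0; rewrite powRD// (gt_eqF x0) implybT. Qed.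

Lemma powRD_ge0 {R : realType} (x a b : R) : 0 <= a -> 0 <= b ->
  x `^ (a + b) = x `^ a * x `^ b.
Proof.
move=> a0 b0; have [ab|ab] := eqVneq (a + b) 0; last by rewrite powRD// (negbTE ab).
have [-> ->] : a = 0 /\ b = 0 by split; lra.
by rewrite addr0 powRr0 mulr1.
Qed.

(** * Finite energy expressed by pointwise majorants; convexity and monotonicity *)

Section majorants.
Context {R : realType} {d : nat}.
Variable mu : {finite_measure set (euclidean R d) -> \bar R}.
Implicit Types (s t theta : R) (z : euclidean R d) (H : euclidean R d -> R).

(** At [theta = 0] the last factor is 1 and only [C] remains. The bound is required off the origin
    only, away from the conventions for powers of 0. *)
Definition energy_majorant s theta := exists C H, [/\ 0 <= C,
  forall z, 0 <= H z, measurable_fun setT H,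
  (\int[lebesgue_euclidean d]_z (H z)%:E < +oo)%E &
  forall z, 0 < enorm z -> fourier_abs mu z ^+ 2 * enorm z `^ s <=
                           C * (enorm z ^+ d * H z) `^ theta].

Lemma measurable_enorm_powR p :
  measurable_fun setT (fun z : euclidean R d => enorm z `^ p).
Proof. exact: (measurableT_comp (measurable_powR p) measurable_enorm). Qed.

Lemma measurable_fourier_powR p :
  measurable_fun setT (fun z => fourier_abs mu z `^ p).
Proof.
exact: (measurableT_comp (measurable_powR p) (measurable_fourier_abs mu)).
Qed.

Lemma energy_lty_majorant s theta : 0 <= theta ->
  (energy mu s theta < +oo)%E -> energy_majorant s theta.
Proof.
rewrite /energy le_eqVlt => /predU1P[<-|theta0].
  rewrite eqxx; set S := (X in ereal_sup X) => Soo.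
  have Sle z : ((fourier_abs mu z ^+ 2 * enorm z `^ s)%:E <= ereal_sup S)%E.
    by apply: ereal_sup_ubound; exists z.
  have [C CE] : exists C, ereal_sup S = C%:E.
    (* The value at the origin shows that the supremum is not -oo; finite energy excludes +oo. *)
    have := Sle [tuple 0 | _ < d].
    by move: Soo; case: (ereal_sup S) => [C _ _|//|//]; exists C.
  exists (Num.max 0 C), (cst 0); split => //.
  - by rewrite le_max lexx.
  - by rewrite integral0.
  - move=> z _; rewrite powRr0 mulr1 le_max; apply/orP; right.
    by rewrite -lee_fin -CE.
have theta_neq0 : theta != 0 by rewrite gt_eqF.
rewrite gt_eqF// => /(lty_poweRy theta_neq0) intoo.
(* With the energy integrand itself as [H], the required bound is an equality. *)
exists 1, (fun z => fourier_abs mu z `^ (2 / theta) * enorm z `^ (s / theta - d%:R)).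
split => //.
- by move=> z; rewrite mulr_ge0 ?powR_ge0.
- apply: measurable_funM; first exact: measurable_fourier_powR.
  exact: measurable_enorm_powR.
- move=> z z0; rewrite mul1r mulrCA -[enorm z ^+ d]powR_mulrn ?enorm_ge0// -powRD_gt0//.
  rewrite addrC subrK powRM ?powR_ge0// -!powRrM !divfK ?gt_eqF//.
  by rewrite powR_mulrn// fourier_abs_ge0.
Qed.

(** Raising the bound to the power 1/theta and dividing by |z|^d bounds the integrand by C^(1/theta)
    H off the origin, which is a null set. *)
Lemma majorant_energy_lty s theta : (0 < d)%N -> 0 < theta ->
  energy_majorant s theta -> (energy mu s theta < +oo)%E.
Proof.
move=> d0 theta0 [C [H [C0 H0 mH intH le_H]]].
rewrite /energy gt_eqF//; apply: poweR_lty.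
set f := fun z => (_ * _)%:E.
have mf : measurable_fun setT f.
  apply/measurable_EFinP/measurable_funM; first exact: measurable_fourier_powR.
  exact: measurable_enorm_powR.
have f0 z : (0 <= f z)%E by rewrite lee_fin mulr_ge0 ?powR_ge0.
have mN := @measurable_enorm0 R d.
rewrite (ge0_negligible_integral mN _ mf)//; last exact: lebesgue_enorm0.
have mD : measurable (setT `\` [set z : euclidean R d | enorm z = 0]).
  exact: measurableD.
apply: (@le_lt_trans _ _ ((C `^ theta^-1)%:E *
    \int[lebesgue_euclidean d]_z (H z)%:E)%E); last first.
  by rewrite lte_mul_pinfty ?lee_fin ?powR_ge0.
rewrite -ge0_integralZl_EFin ?powR_ge0//; last 2 first.
- by move=> z _; rewrite lee_fin.
- exact/measurable_EFinP.
have le_f : (\int[lebesgue_euclidean d]_(z in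
    setT `\` [set z : euclidean R d | enorm z = 0%R]) f z <=
  \int[lebesgue_euclidean d]_(z in
    setT `\` [set z : euclidean R d | enorm z = 0%R]) (C `^ theta^-1 * H z)%:E)%E.
  apply: ge0_le_integral => //.
  - exact: measurable_funTS.
  - by apply/measurable_EFinP/measurable_funTS/measurable_funM.
  move=> z [_ /= zN0]; rewrite lee_fin.
  have z0 : 0 < enorm z by rewrite lt_def enorm_ge0 andbT; exact/eqP.
  have : (fourier_abs mu z ^+ 2 * enorm z `^ s) `^ theta^-1 <=
      (C * (enorm z ^+ d * H z) `^ theta) `^ theta^-1.
    apply: ge0_ler_powR; last exact: le_H.
    - by rewrite invr_ge0 ltW.
    - by rewrite nnegrE mulr_ge0 ?powR_ge0// sqr_ge0.
    - by rewrite nnegrE mulr_ge0 ?powR_ge0.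
  rewrite [leLHS]powRM ?powR_ge0 ?sqr_ge0// [leRHS]powRM ?powR_ge0//.
  rewrite -[fourier_abs mu z ^+ 2]powR_mulrn ?fourier_abs_ge0// -!powRrM.
  rewrite divff ?gt_eqF// powRr1 => [le1|]; last first.
    by rewrite mulr_ge0 ?exprn_ge0 ?enorm_ge0.
  rewrite powRD_gt0// powRN powR_mulrn ?enorm_ge0// mulrA.
  by rewrite ler_pdivrMr ?exprn_gt0// -mulrA [H z * _]mulrC.
apply: le_trans le_f _; apply: ge0_subset_integral => //.
- by apply/measurable_EFinP/measurable_funM.
- by move=> z _; rewrite lee_fin mulr_ge0 ?powR_ge0.
Qed.

(** Boundedness of the Fourier transform supplies the endpoint at 0 for interpolation. *)
Lemma energy_majorant00 : energy_majorant 0 0.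
Proof.
have [M M0 fM] := fourier_abs_bounded mu.
exists (M ^+ 2), (cst 0); split => //.
- exact: sqr_ge0.
- by rewrite integral0.
- move=> z _; rewrite !powRr0 !mulr1 lerXn2r ?nnegrE ?fourier_abs_ge0//.
  exact: ltW.
Qed.

Lemma energy_majorant_convex s0 s1 theta0 theta1 t :
  0 <= theta0 -> 0 <= theta1 -> 0 <= t <= 1 ->
  energy_majorant s0 theta0 -> energy_majorant s1 theta1 ->
  energy_majorant (t * s0 + (1 - t) * s1) (t * theta0 + (1 - t) * theta1).
Proof.
move=> th0 th1 /andP[t0 t1] [C0 [H0 [C00 H00 mH0 iH0 le0]]].
move=> [C1 [H1 [C10 H10 mH1 iH1 le1]]].
have u0 : 0 <= 1 - t by rewrite subr_ge0.
exists (C0 `^ t * C1 `^ (1 - t)), (fun z => H0 z + H1 z); split.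
- by rewrite mulr_ge0 ?powR_ge0.
- by move=> z; rewrite addr_ge0.
- exact: measurable_funD.
- under eq_integral do rewrite EFinD.
  rewrite ge0_integralD//; first exact: lte_add_pinfty.
  + by move=> z _; rewrite lee_fin.
  + exact/measurable_EFinP.
  + by move=> z _; rewrite lee_fin.
  + exact/measurable_EFinP.
move=> z z0; have {}le0 := le0 z z0; have {}le1 := le1 z z0.
have a0 := sqr_ge0 (fourier_abs mu z).
move: (fourier_abs mu z ^+ 2) a0 le0 le1 => a a0; set r := enorm z => le0 le1.
have r0 : 0 <= r by exact: ltW.
have rd0 : 0 <= r ^+ d by exact: exprn_ge0.
(* The left side is the weighted geometric mean of the two quantities that are already bounded. *)
have -> : a * r `^ (t * s0 + (1 - t) * s1) =
    (a * r `^ s0) `^ t * (a * r `^ s1) `^ (1 - t).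
  rewrite !(powRM _ a0 (powR_ge0 _ _)) mulrACA -powRD; last first.
    by rewrite addrC subrK oner_eq0.
  rewrite [t + _]addrC subrK powRr1// powRD_gt0//.
  by rewrite -!powRrM ![_ * t]mulrC ![_ * (1 - t)]mulrC.
have bound C s H theta u : 0 <= C -> 0 <= theta -> 0 <= u -> 0 <= H z ->
    H z <= H0 z + H1 z -> a * r `^ s <= C * (r ^+ d * H z) `^ theta ->
    (a * r `^ s) `^ u <= C `^ u * (r ^+ d * (H0 z + H1 z)) `^ (u * theta).
  move=> C_ge0 theta_ge0 u_ge0 Hz0 HzH le.
  apply: (@le_trans _ _ ((C * (r ^+ d * H z) `^ theta) `^ u)).
    by apply: ge0_ler_powR; rewrite ?nnegrE ?mulr_ge0 ?powR_ge0 ?a0//.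
  rewrite [leLHS]powRM ?powR_ge0// -powRrM [theta * u]mulrC ler_wpM2l ?powR_ge0//.
  apply: ge0_ler_powR; rewrite ?nnegrE ?mulr_ge0 ?addr_ge0//.
  by rewrite ler_wpM2l.
rewrite (powRD_ge0 _ (mulr_ge0 t0 th0) (mulr_ge0 u0 th1)) mulrACA ler_pM ?powR_ge0//.
  by apply: (bound _ _ H0); rewrite ?lerDl//.
by apply: (bound _ _ H1); rewrite ?lerDr//.
Qed.

(** Some positive order survives at the larger parameter. For |z| >= 1 the additional power theta1 -
    theta0 of the weight costs a factor |z|^(-e (theta1 - theta0)), absorbed by lowering [s0]; for
    |z| < 1 boundedness of the Fourier transform is enough. *)
Lemma energy_majorant_mono s0 theta0 theta1 : (0 < d)%N ->
  0 < s0 -> 0 <= theta0 < theta1 -> energy_majorant s0 theta0 ->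
  exists2 s, 0 < s & energy_majorant s theta1.
Proof.
move=> d0 s00 /andP[th0 th01] [C [H [C0 H0 mH iH leH]]].
have th1 : 0 < theta1 by exact: le_lt_trans th01.
have D0 : 0 < theta1 - theta0 by rewrite subr_gt0.
have [M M0 fM] := fourier_abs_bounded mu.
(* This choice gives s = (theta0 + theta1) e >= theta1 e, which makes [s] positive and serves the
   bound inside the unit ball. *)
pose e := s0 / (2 * theta1).
have e0 : 0 < e by rewrite divr_gt0// mulr_gt0.
have s0E : s0 = 2 * theta1 * e by rewrite /e mulrC divfK// gt_eqF// mulr_gt0.
pose s := s0 - (theta1 - theta0) * e.
have s_ge : theta1 * e <= s.
  by have := mulr_ge0 th0 (ltW e0); rewrite /s s0E; lra.
exists s; first by rewrite (lt_le_trans _ s_ge)// mulr_gt0.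
exists (C + M ^+ 2), (fun z => H z + weight e z); split.
- by rewrite addr_ge0// sqr_ge0.
- by move=> z; rewrite addr_ge0// weight_ge0.
- by apply: measurable_funD => //; exact: measurable_weight.
- under eq_integral do rewrite EFinD.
  rewrite ge0_integralD//.
  + by apply: lte_add_pinfty => //; exact: integral_weight_lty.
  + by move=> z _; rewrite lee_fin.
  + exact/measurable_EFinP.
  + by move=> z _; rewrite lee_fin weight_ge0.
  + by apply/measurable_EFinP; exact: measurable_weight.
move=> z z0; have {}leH := leH z z0.
have a0 := sqr_ge0 (fourier_abs mu z).
have aM : fourier_abs mu z ^+ 2 <= M ^+ 2.
  by rewrite lerXn2r ?nnegrE ?fourier_abs_ge0// ltW.
move: (fourier_abs mu z ^+ 2) a0 aM leH => a a0 aM; set r := enorm z => leH.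
have rd0 : 0 <= r ^+ d by rewrite exprn_ge0// ltW.
have wE : r ^+ d * weight e z = Num.min (r `^ e) (r `^ (- e)).
  by rewrite /weight mulrA divff ?mul1r// expf_neq0// gt_eqF.
have w0 := weight_ge0 e z.
have X0 : 0 <= r ^+ d * (H z + weight e z) by rewrite mulr_ge0// addr_ge0.
have wX : r ^+ d * weight e z <= r ^+ d * (H z + weight e z).
  by rewrite ler_wpM2l// lerDr.
have HX : r ^+ d * H z <= r ^+ d * (H z + weight e z).
  by rewrite ler_wpM2l// lerDl.
have powle x y p : 0 <= p -> 0 <= x -> x <= y -> x `^ p <= y `^ p.
  by move=> p0 x0 xy; apply: ge0_ler_powR => //; rewrite nnegrE// (le_trans x0).
have [r1|r1] := leP 1 r.
  have {}wE : r ^+ d * weight e z = r `^ (- e).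
    by rewrite wE min_r//; apply: ler_powR => //; lra.
  rewrite mulrDl; apply: ler_wpDr; first by rewrite mulr_ge0 ?sqr_ge0 ?powR_ge0.
  have -> : s = s0 + - e * (theta1 - theta0) by rewrite /s; ring.
  rewrite powRD_gt0// mulrA.
  (* The exponent splits as theta0 + (theta1 - theta0): [H] controls the first factor, the weight
     the second. *)
  rewrite -[X in _ <= _ * _ `^ X](subrK theta0 theta1) [_ + theta0]addrC.
  rewrite (powRD_ge0 _ th0 (ltW D0)) mulrA powRrM -wE.
  rewrite ler_pM ?mulr_ge0 ?powR_ge0//.
    apply: le_trans leH _; rewrite ler_wpM2l//.
    by apply: powle => //; exact: mulr_ge0.
  by apply: powle; rewrite ?(ltW D0)// mulr_ge0.
(* Inside the unit ball, |z|^s <= |z|^(e theta1), and this is the theta1-th power of |z|^d times the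
   weight. *)
have {}wE : r ^+ d * weight e z = r `^ e.
  by rewrite wE min_l//; apply: ger_powR; [rewrite z0 ltW|lra].
rewrite mulrDl; apply: ler_wpDl; first by rewrite mulr_ge0 ?powR_ge0.
rewrite ler_pM ?powR_ge0//.
apply: (@le_trans _ _ ((r `^ e) `^ theta1)).
  by rewrite -powRrM mulrC; apply: ger_powR; [rewrite z0 ltW|].
by rewrite -wE; apply: powle; rewrite ?(ltW th1)// mulr_ge0.
Qed.

End majorants.

(** * The Fourier spectrum of [mu * mu] and the equivalence *)

Section spectrum.
Context {R : realType} {d : nat}.
Implicit Types (mu : {finite_measure set (euclidean R d) -> \bar R})
  (s x theta : R).

Lemma dimF_ge0 mu theta : (0 <= dimF theta mu)%E.
Proof. by rewrite le_max lexx. Qed.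

(** Since [x] is nonnegative, the default 0 in the maximum cannot be what exceeds it. *)
Lemma lt_dimF mu theta x : 0 <= x -> (x%:E < dimF theta mu)%E ->
  exists2 s, x < s & (energy mu s theta < +oo)%E.
Proof.
move=> x0; rewrite lt_max => /orP[|/ereal_sup_gt[_ [s [_ es] <-]]].
  by rewrite lte_fin => /(le_lt_trans x0); rewrite ltxx.
by rewrite lte_fin; exists s.
Qed.

Lemma le_dimF mu theta s : 0 <= s -> (energy mu s theta < +oo)%E ->
  (s%:E <= dimF theta mu)%E.
Proof.
move=> s0 es; rewrite le_max; apply/orP; right.
by apply: ereal_sup_ubound; exists s.
Qed.

Lemma energy_gt0E mu s theta : 0 < theta -> energy mu s theta =
  poweR (\int[lebesgue_euclidean d]_z
    (fourier_abs mu z `^ (2 / theta) * enorm z `^ (s / theta - d%:R))%:E)%E theta.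
Proof. by move=> theta0; rewrite /energy gt_eqF. Qed.

Lemma poweR_lty_iff (x y : \bar R) (a b : R) : a != 0 -> b != 0 -> x = y ->
  (poweR x a < +oo)%E <-> (poweR y b < +oo)%E.
Proof. by move=> a0 b0 ->; split => /lty_poweRy-/(_ _)/poweR_lty; apply. Qed.

(** Squaring the modulus doubles the exponent 2/theta to 2/(theta/2), and s/theta = (s/2)/(theta/2).
    The two integrals coincide; only the outer powers differ, and these preserve finiteness. *)
Lemma energy_convolution_lty mu s theta : 0 < theta ->
  (energy (convolution mu mu) s theta < +oo)%E <->
  (energy mu (s / 2) (theta / 2) < +oo)%E.
Proof.
move=> th0; have th2 : 0 < theta / 2 by rewrite divr_gt0.
have th_neq0 : theta != 0 by rewrite gt_eqF.
have th2_neq0 : theta / 2 != 0 by rewrite gt_eqF.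
have powE z : fourier_abs (convolution mu mu) z `^ (2 / theta) =
    fourier_abs mu z `^ (2 / (theta / 2)).
  rewrite fourier_abs_convolution -powR_mulrn ?fourier_abs_ge0// -powRrM.
  by congr (_ `^ _); field; rewrite gt_eqF.
have sE : s / theta = s / 2 / (theta / 2) by field.
rewrite (energy_gt0E _ _ th0) (energy_gt0E _ _ th2); apply: (poweR_lty_iff th_neq0 th2_neq0).
by apply: eq_integral => z _; rewrite powE sE.
Qed.

Lemma dimF_convolution_gt mu theta : 0 < theta -> (0 < d)%N ->
  (dimF theta mu < dimF theta (convolution mu mu))%E <->
  exists lam : R, 0 <= lam < 1 /\
    (scale_dim lam (dimF theta mu) < dimF (lam * theta) mu)%E.
Proof.
move=> th0 d0; rewrite /scale_dim.
have [[F FE F0]|Foo] : (exists2 F, dimF theta mu = F%:E & 0 <= F) \/ dimF theta mu = +oo%E.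
  by move: (dimF_ge0 mu theta); case: (dimF theta mu) => [F F0|_|//]; [left; exists F|right].
  rewrite FE/=; split.
    move=> /(lt_dimF F0)[s Fs /(energy_convolution_lty mu s th0) es].
    exists 2^-1; split; first by apply/andP; split; lra.
    rewrite [2^-1 * theta]mulrC; apply: (@lt_le_trans _ _ (s / 2)%:E).
      by rewrite -EFinM lte_fin; lra.
    by apply: le_dimF es; lra.
  move=> [lam [/andP[lam0 lam1]]]; rewrite -EFinM.
  have lF0 : 0 <= lam * F by rewrite mulr_ge0.
  have lth0 : 0 <= lam * theta by rewrite mulr_ge0// ltW.
  move=> /(lt_dimF lF0)[s Fs /(energy_lty_majorant lth0) ms].
  (* An order above F/2 at theta/2 doubles to an order above [F] for the convolution at theta. *)
  suff [s' Fs' ms'] : exists2 s', F / 2 < s' & energy_majorant mu s' (theta / 2).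
    apply: (@lt_le_trans _ _ (2 * s')%:E); first by rewrite lte_fin; lra.
    apply: le_dimF; first by lra.
    apply/energy_convolution_lty => //; rewrite mulrC mulKf//.
    by apply: majorant_energy_lty => //; rewrite divr_gt0.
  have [lam2|lam2] := leP 2^-1 lam.
    (* Chosen so that the point dividing 0 and lam theta with weight [t] on the latter is
       theta/2. *)
    pose t := (2 * lam)^-1.
    have lamp : 0 < lam by lra.
    have tlam : t * lam = 2^-1 by rewrite /t; field; rewrite gt_eqF.
    have t0 : 0 < t by rewrite invr_gt0 mulr_gt0.
    have t01 : 0 <= t <= 1.
      by apply/andP; split; [exact: ltW|rewrite invf_le1; lra].
    have := energy_majorant_convex lth0 (lexx 0) t01 ms (energy_majorant00 mu).
    rewrite !mulr0 !addr0 mulrA tlam [2^-1 * _]mulrC; exists (t * s) => //.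
    have : t * (lam * F) < t * s by rewrite ltr_pM2l.
    by rewrite mulrA tlam mulrC.
  move: F0; rewrite le_eqVlt => /predU1P[F0|F0].
    (* Here [F = 0], so any positive order at theta/2 will do, and lam theta < theta/2. *)
    rewrite -F0 mul0r; apply: energy_majorant_mono ms => //.
      exact: le_lt_trans lF0 Fs.
    by rewrite lth0 [_ / 2]mulrC ltr_pM2r.
  (* Chosen so that t lam theta + (1 - t) theta = theta/2; it is below 1 because lam < 1/2. *)
  pose t := (2 * (1 - lam))^-1.
  have lamp : 0 < 1 - lam by lra.
  have tlam : t * lam + (1 - t) = 2^-1 by rewrite /t; field; rewrite gt_eqF.
  have t0 : 0 < t by rewrite invr_gt0 mulr_gt0.
  have t1 : t < 1 by rewrite invf_lt1; lra.
  have t01 : 0 <= t <= 1 by rewrite !ltW.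
  (* The order at theta for which interpolation with [s] gives exactly F/2. It lies below [F]
     because s > lam F, so an order [s1] of finite energy exists above it. *)
  pose y := F - t * (s - lam * F) / (1 - t).
  have yF : Num.max 0 y < F.
    by rewrite gt_max F0 ltrBlDr ltrDl divr_gt0 ?mulr_gt0 ?subr_gt0.
  have max0 : 0 <= Num.max 0 y by rewrite le_max lexx.
  have [s1] := @lt_dimF mu theta (Num.max 0 y) max0 ltac:(by rewrite FE lte_fin).
  rewrite gt_max => /andP[s10 ys1] /(energy_lty_majorant (ltW th0)) ms1.
  have := energy_majorant_convex lth0 (ltW th0) t01 ms ms1.
  rewrite mulrA -mulrDl tlam [2^-1 * _]mulrC; exists (t * s + (1 - t) * s1) => //.
  have : (1 - t) * y < (1 - t) * s1 by rewrite ltr_pM2l// subr_gt0.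
  rewrite /y mulrBr mulrC [(1 - t) * (_ / _)]mulrC divfK; last by rewrite gt_eqF// subr_gt0.
  have -> : F / 2 = (t * lam + (1 - t)) * F by rewrite tlam mulrC.
  lra.
(* For infinite dimension both sides are false: [scale_dim] returns +oo for every [lam]. *)
rewrite Foo eqxx; split; first by rewrite ltNge leey.
by move=> [lam [_]]; rewrite ltNge leey.
Qed.

End spectrum.

Theorem corollary6p3 (R : realType) (d : nat) (d_gt0 : (0 < d)%N)
    (mu : {finite_measure set (euclidean R d) -> \bar R}) :
  (forall theta : R, 0 < theta <= 1 ->
     ((dimF theta mu < dimF theta (convolution mu mu))%E <->
      exists lam : R, 0 <= lam < 1 /\
        (scale_dim lam (dimF theta mu) < dimF (lam * theta) mu)%E)) /\
  ((dimS mu < dimS (convolution mu mu))%E <->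
   exists lam : R, 0 <= lam < 1 /\
     (scale_dim lam (dimS mu) < dimF lam mu)%E).
Proof.
split=> [theta /andP[theta0 _]|]; first exact: dimF_convolution_gt.
rewrite /dimS dimF_convolution_gt//.
by split=> -[lam]; rewrite ?mulr1; exists lam; rewrite ?mulr1.
Qed.
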